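(* Let $n\ge 3$ be an odd number. Then the set of all $\mathcal{P}$-positions of the $n$-dimensional Wythoff's game with move vectors \[V=\{(1,0,\dots,0),(0,1,\dots,0),\dots,(0,0,\dots,1),(1,1,\dots,1)\}\] (the $n$ standard basis vectors together with the all-ones vector) is \[P^{(n)}=\{(x_1,x_2,\dots,x_n)\in\mathbb{N}^n : x_1\oplus x_2\oplus\dots\oplus x_n=0\}.\]
   Context: $\mathbb{N}$ denotes the non-negative integers, and $\oplus$ denotes the bitwise exclusive OR (Nim-sum) of non-negative integers. The $n$-dimensional Wythoff's game with a set of move vectors $V\subset\mathbb{N}^n\setminus\{\mathbf{0}\}$ is the following two-player game. A position is a tuple $x=(x_1,\dots,x_n)\in\mathbb{N}^n$ (the numbers of tokens in $n$ heaps). The players move alternately; from position $x$ the player in turn chooses $v\in V$ and an integer $k\ge 1$ with $x-kv\in\mathbb{N}^n$ and moves to $x-kv$. The player in turn who has no legal move loses. A position is an $\mathcal{N}$-position if the player about to move from it has a winning strategy; it is a $\mathcal{P}$-position if the other player (who moves second from it) has a winning strategy whatever the first player does. Equivalently, a position is a $\mathcal{P}$-position if and only if no legal move from it leads to a $\mathcal{P}$-position. *)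

(* Defs.v *)
From mathcomp Require Import all_boot.
From mathcomp Require Import boolp classical_sets.
From Stdlib Require Import PeanoNat.

Set Implicit Arguments.
Unset Strict Implicit.
Unset Printing Implicit Defensive.

Local Open Scope classical_set_scope.

(* Also used for move vectors. *)
Definition position (n : nat) := {ffun 'I_n -> nat}.

Section Game.
Variables (n : nat) (V : set (position n)).

(* [y = x - k v], written without truncated subtraction, so that
   [x - k v] having non-negative coordinates is built in. *)
Definition legal_move (x y : position n) : Prop :=
  exists v : position n, V v /\
  exists k : nat, 1 <= k /\ forall i : 'I_n, x i = y i + k * v i.

Definition terminal (x : position n) : Prop := forall y, ~ legal_move x y.

(* [p 0, ..., p m] are the positions of a (partial) play of [m] moves; the
   values of [p] beyond [m] are irrelevant. *)
Definition is_play (p : nat -> position n) (m : nat) : Prop :=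
  forall t, t < m -> legal_move (p t) (p t.+1).

(* A strategy chooses the next position from the sequence of all positions
   reached so far, the current one being last. *)
Definition strategy := seq (position n) -> position n.

(* The players are identified with booleans: [false] moves first, so that the
   player in turn after [t] moves is [odd t]. *)
Definition follows (b : bool) (s : strategy) (p : nat -> position n) (m : nat)
    : Prop :=
  forall t, t < m -> odd t = b -> p t.+1 = s (mkseq p t.+1).

(* Against every behaviour of the opponent, [s] gives player [b] a legal move
   whenever [b] is in turn, and every completed play has the opponent in turn
   at its end. Infinite plays need no clause: when [0] is not in [V],
   each move decreases the total number of tokens. *)
Definition winning_strategy (x : position n) (b : bool) (s : strategy) : Prop :=
  forall p m, p 0 = x -> is_play p m -> follows b s p m ->
    (odd m = b -> legal_move (p m) (s (mkseq p m.+1))) /\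
    (terminal (p m) -> odd m = ~~ b).

Definition N_position (x : position n) : Prop :=
  exists s, winning_strategy x false s.

Definition P_position (x : position n) : Prop :=
  exists s, winning_strategy x true s.

End Game.

Definition unit_vector (n : nat) (j : 'I_n) : position n :=
  [ffun i => nat_of_bool (i == j)].

Definition all_ones (n : nat) : position n := [ffun=> 1].

Definition wythoff_vectors (n : nat) : set (position n) :=
  range (@unit_vector n) `|` [set all_ones n].

Arguments wythoff_vectors n : clear implicits.

Definition nim_sum (n : nat) (x : position n) : nat :=
  \big[Nat.lxor/0]_(i < n) x i.

(* Main.v *)
From HB Require Import structures.
From Stdlib Require Import PeanoNat.
Require Import Defs.
From mathcomp Require Import all_boot.
From mathcomp Require Import boolp classical_sets.
From mathcomp Require Import zify.

Local Open Scope classical_set_scope.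

(** The vanishing of the Nim-sum is a kernel of the move graph.  A move in a
single heap changes one term of the Nim-sum, hence the sum.  A diagonal move
by [k = 2 ^ p * (2 m + 1)] leaves the bits below [p] unchanged and flips bit
[p] of every coordinate; as [n] is odd, bit [p] of the Nim-sum flips too.
From a nonzero Nim-sum, Bouton's move in a single heap restores zero.  Moving
into the kernel is a winning strategy for the player who can do it, and two
opposing winning strategies would produce an infinite play. *)

Section Kernel.
Variables (n : nat) (V : set (position n)).
Hypothesis V_nonzero : forall v, V v -> exists i, 0 < v i.

(** This measure rules out infinite plays: no coordinate grows, and one where [v] is positive
    shrinks since [k >= 1]. *)
Lemma legal_move_sum (x y : position n) :
  legal_move V x y -> \sum_i y i < \sum_i x i.
Proof.
move=> [v [/V_nonzero [j vj] [k [k1 xE]]]].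
rewrite (bigD1 j) //= [X in _ < X](bigD1 j) //= -addSn leq_add //.
  by rewrite xE -[X in X < _]addn0 ltn_add2l muln_gt0 k1.
by apply: leq_sum => i _; rewrite xE leq_addr.
Qed.

Lemma P_N_exclusive (x : position n) : P_position V x -> ~ N_position V x.
Proof.
move=> [s1 w1] [s0 w0].
pose s t h := if odd t then s1 h else s0 h.
(* The two strategies play each other; [hist t] holds all positions up to time [t], since strategies
   read the whole history. *)
pose hist := fix hist t :=
  if t is t'.+1 then rcons (hist t') (s t' (hist t')) else [:: x].
pose p t := last x (hist t).
have pS t : p t.+1 = s t (hist t) by rewrite /p /= last_rcons.
have histE t : mkseq p t.+1 = hist t.
  elim: t => [//|t IH].
  by rewrite /mkseq -addn1 iotaD map_cat -/(mkseq _ _) IH cats1 add0n pS.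
have f1 m : follows true s1 p m by move=> t _ ot; rewrite pS histE /s ot.
have f0 m : follows false s0 p m by move=> t _ ot; rewrite pS histE /s ot.
have play m : is_play V p m.
  elim: m => [//|m IH] t; rewrite ltnS leq_eqVlt => /predU1P[->|]; last exact: IH.
  have [l1 _] := w1 p m erefl IH (f1 m).
  have [l0 _] := w0 p m erefl IH (f0 m).
  by move: l1 l0; rewrite pS histE /s; case: (odd m) => l1 l0; [apply: l1|apply: l0].
(* Each move costs at least one token, so the play cannot outlast the initial total. *)
have decr t : \sum_i p t i + t <= \sum_i x i.
  elim: t => [|t IH]; first by rewrite addn0.
  apply: leq_trans IH; rewrite addnS -addSn leq_add2r.
  exact/legal_move_sum/(play t.+1).
by have := decr (\sum_i x i).+1; rewrite leqNgt addnS ltnS leq_addl.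
Qed.

Variable K : pred (position n).
Hypothesis K_stable : forall x y, K x -> legal_move V x y -> ~~ K y.
Hypothesis K_absorbing : forall x, ~~ K x -> exists2 y, legal_move V x y & K y.

(** The boolean [K x] serves as the winner's name: the second player [true] if [x] is in the kernel,
    the first player [false] otherwise. *)
Lemma kernel_winning (x : position n) :
  exists s, winning_strategy V x (K x) s.
Proof.
have /choice [f fP] : forall z, exists y, ~~ K z -> legal_move V z y /\ K y.
  by move=> z; case: (boolP (K z)) => [|/K_absorbing [y]]; [exists z|exists y].
exists (fun h => f (last x h)) => p m p0 play fol.
have lastE t : last x (mkseq p t.+1) = p t.
  by rewrite /mkseq -addn1 iotaD map_cat last_cat.
(* Equivalently, the position lies outside [K] exactly when player [K x] is in turn. *)
have inv t : t <= m -> K (p t) = odd t (+) K x.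
  elim: t => [|t IH] tm; first by rewrite p0.
  have := IH (ltnW tm); have := fol t tm; rewrite lastE /=.
  have := play t tm.
  case: (boolP (K (p t))) => Kt mv; last first.
    case: (odd t) (K x) => [] [] // E _; rewrite E //;
    by have [_ ->] := fP _ Kt.
  have /negbTE -> := K_stable _ _ Kt mv.
  by case: (odd t) (K x) => [] [].
have := inv m (leqnn m); rewrite lastE => Km; split.
  by move=> om; apply: (fP _ _).1; rewrite Km om addbb.
move=> term; case: (boolP (K (p m))) Km => [_|/K_absorbing [y /term]] //.
by case: (odd m) (K x) => [] [].
Qed.

Lemma P_position_kernel (x : position n) : P_position V x <-> K x.
Proof.
have [s] := kernel_winning x.
case: (K x) => w; split=> // Px; first by exists s.
by case: (P_N_exclusive x Px); exists s.
Qed.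

End Kernel.

Lemma pow2E (p : nat) : Nat.pow 2 p = 2 ^ p.
Proof. by elim: p => //= p ->; rewrite expnS; lia. Qed.

(** Dividing by [2 ^ p] turns the added term into an odd number, which flips the parity of the
    quotient. *)
Lemma testbit_add_odd_pow2 (a p m : nat) :
  Nat.testbit (a + m.*2.+1 * 2 ^ p) p = ~~ Nat.testbit a p.
Proof.
have p0 : Nat.pow 2 p <> 0 by rewrite pow2E; have := expn_gt0 2 p; lia.
rewrite !Nat.testbit_odd !Nat.shiftr_div_pow2 -pow2E Nat.div_add //.
have -> : m.*2.+1 = S (2 * m)%coq_nat by lia.
by rewrite -plus_n_Sm Nat.odd_succ Nat.even_add_mul_2 Nat.negb_odd.
Qed.

(** The top bit [d] of [s] is cleared in [a] and all higher bits stay, so the quotient by [2 ^ d]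
    drops from [2 h + 1] to [2 h]. *)
Lemma lxor_lt (a s : nat) : s <> 0 -> Nat.testbit a (Nat.log2 s) ->
  Nat.lxor a s < a.
Proof.
move=> s0; set d := Nat.log2 s => ad.
have s_top : Nat.div s (Nat.pow 2 d) = 1.
  have [] := Nat.log2_spec s; first lia.
  rewrite -/d Nat.pow_succ_r' => le lt.
  apply/esym/(Nat.div_unique _ _ _ (s - Nat.pow 2 d)); lia.
have [l [h [l_lt]]] := Nat.testbit_spec a d; rewrite ad /= => aE.
have a_top : Nat.div a (Nat.pow 2 d) = (2 * h).+1.
  apply/esym/(Nat.div_unique _ _ _ l); lia.
have lxor1 : Nat.lxor (2 * h).+1 1 = 2 * h.
  apply: Nat.bits_inj => -[|i]; rewrite Nat.lxor_spec.
    by rewrite Nat.testbit_even_0 -addn1 Nat.testbit_odd_0.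
  rewrite Nat.testbit_even_succ' -addn1 Nat.testbit_odd_succ'.
  by rewrite (Nat.testbit_odd_succ' 0) Nat.bits_0; case: Nat.testbit.
rewrite ltnNge; apply/negP => /leP /(Nat.Div0.div_le_mono _ _ (Nat.pow 2 d)).
rewrite -[Nat.div (Nat.lxor a s) _]Nat.shiftr_div_pow2 Nat.shiftr_lxor !Nat.shiftr_div_pow2.
rewrite s_top a_top lxor1; lia.
Qed.

HB.instance Definition _ := Monoid.isComLaw.Build nat 0 Nat.lxor
  (fun a b c => esym (Nat.lxor_assoc a b c)) Nat.lxor_comm Nat.lxor_0_l.

Lemma testbit_nim_sum (n : nat) (x : position n) (p : nat) :
  Nat.testbit (nim_sum x) p = \big[addb/false]_(i < n) Nat.testbit (x i) p.
Proof.
apply: (big_morph (fun a => Nat.testbit a p)) => [a b|]; last exact: Nat.bits_0.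
by rewrite Nat.lxor_spec; do 2!case: Nat.testbit.
Qed.

(** Negation is addition of [true] modulo 2, and [n] copies of [true] add up to the parity of
    [n]. *)
Lemma big_addb_negb (n : nat) (f : 'I_n -> bool) :
  \big[addb/false]_(i < n) ~~ f i = odd n (+) \big[addb/false]_(i < n) f i.
Proof.
under eq_bigr do rewrite -addTb.
rewrite big_split /= big_const_ord; congr (_ (+) _).
Qed.

Section Wythoff.
Variable n : nat.
Implicit Types x y : position n.

Lemma wythoff_vectors_nonzero (n_gt0 : 0 < n) (v : position n) :
  wythoff_vectors n v -> exists i, 0 < v i.
Proof.
move=> [[j _ <-]|->]; first by exists j; rewrite ffunE eqxx.
by exists (Ordinal n_gt0); rewrite ffunE.
Qed.

Lemma nim_sum_stable (n_odd : odd n) x y :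
  nim_sum x = 0 -> legal_move (wythoff_vectors n) x y -> nim_sum y <> 0.
Proof.
move=> x0 [v [Vv [k [k1 xE]]]] y0.
case: Vv xE => [[j _ <-]|->] xE.
  have xyj i : i != j -> x i = y i.
    by move=> /negbTE ij; rewrite xE ffunE ij muln0 addn0.
  (* With both Nim-sums zero, [x j] and [y j] would both equal the Nim-sum of the unchanged
     heaps. *)
  have : Nat.lxor (x j) (\big[Nat.lxor/0]_(i < n | i != j) x i) = 0.
    by rewrite -[RHS]x0 /nim_sum [RHS](bigD1 j).
  rewrite (eq_bigr _ xyj) => /Nat.lxor_eq xj.
  have : Nat.lxor (y j) (\big[Nat.lxor/0]_(i < n | i != j) y i) = 0.
    by rewrite -[RHS]y0 /nim_sum [RHS](bigD1 j).
  move=> /Nat.lxor_eq yj.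
  by have := xE j; rewrite ffunE eqxx xj -yj; lia.
(* Diagonal move: [p] is the 2-adic valuation of [k]. *)
have [p [m kE]] : exists p m, k = m.*2.+1 * 2 ^ p.
  have [q q_odd kE] := pfactor_coprime (isT : prime 2) k1.
  rewrite coprime2n in q_odd; exists (logn 2 k), q./2.
  by rewrite [LHS]kE; congr (_ * _); rewrite -[LHS]odd_double_half q_odd.
have xy i : Nat.testbit (x i) p = ~~ Nat.testbit (y i) p.
  by rewrite xE ffunE muln1 kE testbit_add_odd_pow2.
have := congr1 (Nat.testbit ^~ p) y0.
have := congr1 (Nat.testbit ^~ p) x0.
rewrite /= !testbit_nim_sum (eq_bigr _ (fun i _ => xy i)) big_addb_negb n_odd.
by move=> + yp; rewrite yp Nat.bits_0.
Qed.

Lemma nim_sum_absorbing x : nim_sum x <> 0 ->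
  exists2 y, legal_move (wythoff_vectors n) x y & nim_sum y = 0.
Proof.
move=> s0; set s := nim_sum x in s0.
(* The top bit of [s] is set, so it cannot vanish in every heap. *)
have [j xj] : exists j, Nat.testbit (x j) (Nat.log2 s).
  apply: contrapT => /forallNP no.
  have := Nat.bit_log2 _ s0; rewrite testbit_nim_sum big1 // => i _.
  exact/negbTE/negP.
have lt := lxor_lt _ _ s0 xj.
pose y : position n := [ffun i => if i == j then Nat.lxor (x j) s else x i].
exists y.
  exists (unit_vector j); split; first by left; exists j.
  exists (x j - Nat.lxor (x j) s); split; first by rewrite subn_gt0.
  move=> i; rewrite !ffunE; case: eqP => [->|_]; last by rewrite muln0 addn0.
  by rewrite muln1 subnKC // ltnW.
rewrite /nim_sum (bigD1 j) //= ffunE eqxx.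
under eq_bigr => i /negbTE ij do rewrite ffunE ij.
have sE : s = Nat.lxor (x j) (\big[Nat.lxor/0]_(i < n | i != j) x i).
  by rewrite /s /nim_sum (bigD1 j).
(* The new heap [j] equals the Nim-sum of the other heaps, which it cancels. *)
rewrite {1}sE -Nat.lxor_assoc Nat.lxor_nilpotent Nat.lxor_0_l.
exact: Nat.lxor_nilpotent.
Qed.

End Wythoff.

Theorem theorem3 (n : nat) (n_ge3 : 3 <= n) (n_odd : odd n) :
  [set x : position n | P_position (wythoff_vectors n) x] =
  [set x : position n | nim_sum x = 0].
Proof.
pose K : pred (position n) := fun x => nim_sum x == 0.
have v0 := wythoff_vectors_nonzero n (ltnW (ltnW n_ge3)).
have stable x y : K x -> legal_move (wythoff_vectors n) x y -> ~~ K y.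
  by move=> /eqP x0 mv; apply/eqP/(nim_sum_stable n n_odd x y).
have absorb x : ~~ K x -> exists2 y, legal_move (wythoff_vectors n) x y & K y.
  by move=> /eqP /nim_sum_absorbing [y mv /eqP]; exists y.
apply/seteqP; split=> x /=.
  by move=> /(P_position_kernel n _ v0 K stable absorb) /eqP.
by move=> /eqP Kx; apply/(P_position_kernel n _ v0 K stable absorb).
Qed.
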